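(* Let $s,t$ be positive integers and $1/t\ge\epsilon>0$. Let $M=(m_{i,j})_{1\le i\le s,\,1\le j\le t}$ be a real matrix such that $\epsilon\le m_{i,j}$ for all $i,j$ and $\sum_{1\le j\le t}m_{i,j}=1$ for all $1\le i\le s$. Endow both $\mathbb{R}^s$ and $\mathbb{R}^t$ with the norm $|x|=\sum_i|x_i|$. Let $0\ne x=(x_1,\dots,x_s)\in\mathbb{R}^s$ be orthogonal, in the usual sense, to $(1,1,\dots,1)\in\mathbb{R}^s$, i.e. $\sum_{1\le i\le s}x_i=0$. Let $y=xM\in\mathbb{R}^t$ (with $x$ regarded as a row vector). Then $|y|\le(1-t\epsilon)|x|$.
   Context: No special context is needed. *)

(* Defs.v *)
From mathcomp Require Import all_boot all_order all_algebra.
From mathcomp Require Import reals.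

Set Implicit Arguments.
Unset Strict Implicit.
Unset Printing Implicit Defensive.

Import Order.TTheory GRing.Theory Num.Theory.

Local Open Scope ring_scope.

(* Not the norm `|x| that MathComp-Analysis puts on matrices, which is the
   maximum norm. *)
Definition l1norm (R : realType) (n : nat) (x : 'rV[R]_n) : R :=
  \sum_(i < n) `|x 0 i|.

(* Main.v *)
Require Import Defs.
From mathcomp Require Import all_boot all_order all_algebra.
From mathcomp Require Import reals.

(** Subtracting the constant [eps] from every entry of [M] does not change
    [x *m M], because the entries of [x] add up to zero
    ([mulmx_sub_const_mx]). The shifted matrix is still nonnegative, and each of
    its rows now adds up to [1 - t * eps]. A nonnegative matrix expands the
    l1-norm of row vectors by at most its largest row sum, by the triangle
    inequality ([l1norm_mulmx_le]), which is the claimed contraction. *)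

Set Implicit Arguments.
Unset Strict Implicit.
Unset Printing Implicit Defensive.

Import Order.TTheory GRing.Theory Num.Theory.

Local Open Scope ring_scope.

(** Each row of a constant matrix is the same, so multiplying by it only sees
    the sum of the entries of [x]. *)
Lemma mulmx_sub_const_mx (R : pzRingType) (m n : nat) (a : R)
    (x : 'rV[R]_m) (M : 'M[R]_(m, n)) :
  \sum_(i < m) x 0 i = 0 -> x *m (M - const_mx a) = x *m M.
Proof.
move=> x_sum0; rewrite mulmxBr [X in _ - X](_ : _ = 0) ?subr0 //.
apply/rowP => j; rewrite !mxE.
under eq_bigr do rewrite mxE.
by rewrite -mulr_suml x_sum0 mul0r.
Qed.

(** By the triangle inequality, coordinate [i] of [x] contributes at most
    [`|x 0 i|] times the sum of row [i]; this needs the order of summation to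
    be exchanged. *)
Lemma l1norm_mulmx_le (R : realType) (m n : nat) (c : R)
    (x : 'rV[R]_m) (N : 'M[R]_(m, n)) :
    (forall i j, 0 <= N i j) -> (forall i, \sum_(j < n) N i j <= c) ->
  l1norm (x *m N) <= c * l1norm x.
Proof.
move=> N_ge0 N_sum; rewrite /l1norm mulr_sumr.
apply: (@le_trans _ _ (\sum_(j < n) \sum_(i < m) `|x 0 i| * N i j)).
  apply: ler_sum => j _; rewrite mxE.
  apply: le_trans (ler_norm_sum _ _ _) _.
  by apply: ler_sum => i _; rewrite normrM (ger0_norm (N_ge0 i j)).
rewrite exchange_big; apply: ler_sum => i _.
by rewrite -mulr_sumr mulrC ler_wpM2r.
Qed.

Theorem lemma6p6 (R : realType) (s t : nat) (hs : (0 < s)%N) (ht : (0 < t)%N)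
    (eps : R) (eps_le : eps <= 1 / t%:R) (eps_gt0 : 0 < eps)
    (M : 'M[R]_(s, t))
    (M_ge : forall (i : 'I_s) (j : 'I_t), eps <= M i j)
    (M_sum : forall i : 'I_s, \sum_(j < t) M i j = 1)
    (x : 'rV[R]_s) (x_neq0 : x <> 0)
    (x_orth : \sum_(i < s) x 0 i = 0) :
  l1norm (x *m M) <= (1 - t%:R * eps) * l1norm x.
Proof.
rewrite -(mulmx_sub_const_mx eps M x_orth).
apply: l1norm_mulmx_le => [i j|i]; first by rewrite !mxE subr_ge0.
under eq_bigr do rewrite !mxE.
by rewrite sumrB M_sum sumr_const card_ord mulr_natl.
Qed.
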